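(* Let $m,n\geq 6$ and $r\geq 3$. Then $\rho(\mathcal{P}^r_{m-5}\cup\mathcal{W}_{n-1})=\rho(\mathcal{P}^r_{n-5}\cup\mathcal{W}_{m-1})$ and $ME(\mathcal{P}^r_{m-5}\cup\mathcal{W}_{n-1})=ME(\mathcal{P}^r_{n-5}\cup\mathcal{W}_{m-1})$.
   Context: The loose path $\mathcal{P}^r_t=v_1e_1v_2\cdots v_te_tv_{t+1}$ of length $t\geq 1$ has edges $e_i=\{v_i,u_{i,1},\dots,u_{i,r-2},v_{i+1}\}$, all listed vertices distinct. For $N\geq 5$, $\mathcal{W}_N$ is obtained from $\mathcal{P}^r_{N-2}$ (vertices $v_1,\dots,v_{N-1}$) by attaching one pendent edge (an edge containing one existing vertex and $r-1$ new vertices) at $v_2$ and one at $v_{N-2}$. $\cup$ denotes disjoint union. For an $r$-uniform hypergraph $\mathcal{K}$ on $n'$ vertices, $m(\mathcal{K},k)$ is the number of sets of $k$ pairwise disjoint edges ($m(\mathcal{K},0)=1$), $\varphi(\mathcal{K},x)=\sum_{k\geq0}(-1)^km(\mathcal{K},k)x^{n'-kr}$ is the matching polynomial, and $ME(\mathcal{K})$ is the sum of absolute values of all roots (with multiplicity) of $\varphi(\mathcal{K},x)$. The adjacency tensor has entries $a_{i_1\cdots i_r}=1/(r-1)!$ if $\{i_1,\dots,i_r\}$ is an edge and $0$ otherwise; $\lambda$ is an eigenvalue if some nonzero $x\in\mathbb{C}^{n'}$ satisfies $\sum_{i_2,\dots,i_r}a_{ii_2\cdots i_r}x_{i_2}\cdots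 x_{i_r}=\lambda x_i^{r-1}$ for all $i$; $\rho(\mathcal{K})$ is the maximum modulus of the eigenvalues. *)

(* Defs.v *)
From HB Require Import structures.
From mathcomp Require Import all_boot all_order all_algebra.
From mathcomp Require Import classical_sets reals.
From mathcomp Require Import complex.
Set Implicit Arguments. Unset Strict Implicit. Unset Printing Implicit Defensive.
Import Order.TTheory GRing.Theory Num.Theory.

Record hgraph := HG { hv : nat; he : {set {set 'I_hv}} }.

Definition hunion (K1 K2 : hgraph) : hgraph :=
  @HG (hv K1 + hv K2)
    ([set (@lshift (hv K1) (hv K2)) @: e | e : {set 'I_(hv K1)} in he K1] :|:
     [set (@rshift (hv K1) (hv K2)) @: e | e : {set 'I_(hv K2)} in he K2]).

(* Loose path P^r_t: vertices 0 .. t(r-1); v_{j+1} = j(r-1) and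
   e_{j+1} = {j(r-1), j(r-1)+1, ..., (j+1)(r-1)} for j < t. *)
Definition loose_path (r t : nat) : hgraph :=
  @HG (t * (r - 1)).+1
    [set [set v : 'I_(t * (r - 1)).+1 | (j * (r - 1) <= v <= j.+1 * (r - 1))%N]
       | j : 'I_t].

(* W_N: loose path P^r_(N-2) (vertices v_1..v_(N-1), v_i = (i-1)(r-1)),
   plus a pendent edge at v_2 with new vertices p .. p+r-2 and a pendent edge
   at v_(N-2) with new vertices p+r-1 .. p+2r-3, where p = (N-2)(r-1)+1. *)
Definition W_graph (r N : nat) : hgraph :=
  let p := ((N - 2) * (r - 1)).+1 in
  @HG (p + 2 * (r - 1))
    ([set [set v : 'I_(p + 2 * (r - 1)) | (j * (r - 1) <= v <= j.+1 * (r - 1))%N]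
       | j : 'I_(N - 2)] :|:
     [set [set v : 'I_(p + 2 * (r - 1)) |
            (v == r - 1 :> nat) || (p <= v < p + (r - 1))%N];
          [set v : 'I_(p + 2 * (r - 1)) |
            (v == (N - 3) * (r - 1) :> nat) ||
            (p + (r - 1) <= v < p + 2 * (r - 1))%N]]).

Local Open Scope ring_scope.

Section Spectral.
Variable R : realType.
Local Notation C := R[i].

Definition adj_entry (r : nat) (K : hgraph) (i : 'I_(hv K))
    (t : {ffun 'I_r.-1 -> 'I_(hv K)}) : C :=
  if (i |: [set t j | j : 'I_r.-1]) \in he K then ((r.-1)`!%:R)^-1 else 0.

Definition tensor_eigenvalue (r : nat) (K : hgraph) (lambda : C) : Prop :=
  exists x : {ffun 'I_(hv K) -> C}, x != 0 /\
    forall i : 'I_(hv K),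
      \sum_(t : {ffun 'I_r.-1 -> 'I_(hv K)}) @adj_entry r K i t * \prod_(j : 'I_r.-1) x (t j)
      = lambda * x i ^+ r.-1.

Definition spectral_radius (r : nat) (K : hgraph) : R :=
  sup [set Normc.normc lambda | lambda in tensor_eigenvalue r K].

Definition matching_number (K : hgraph) (k : nat) : nat :=
  #|[set S : {set {set 'I_(hv K)}} | (S \subset he K) && (#|S| == k) &&
       [forall e in S, forall f in S, (e != f) ==> [disjoint e & f]]]|.

Definition matching_poly (r : nat) (K : hgraph) : {poly C} :=
  \sum_(k < (hv K).+1) ((-1) ^+ k * (matching_number K k)%:R) *: 'X^(hv K - k * r).

Definition poly_roots (p : {poly C}) : seq C := sval (closed_field_poly_normal p).

Definition matching_energy (r : nat) (K : hgraph) : R :=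
  \sum_(z <- poly_roots (matching_poly r K)) Normc.normc z.

End Spectral.

(* Main.v *)
Require Import Defs.
From HB Require Import structures.
From mathcomp Require Import all_boot all_order all_algebra.
From mathcomp Require Import classical_sets reals.
From mathcomp Require Import complex.
From mathcomp Require Import zify ring lra.
(* Write [F t] for the generating function [sum_k m(K, k) X^k] of the loose path
   with [t] edges ([F (-1) = F 0 = 1]), so that [F (t + 2) = F (t + 1) + X F t].  Deleting the four end
   edges of [W_N] one by one, with [t = N - 2], gives
     [F (t - 2) + 4 X F (t - 3) + 4 X^2 F (t - 4) = (1 + 4 X) F (t - 2)],
   so the matching numbers of [P_(m-5) U W_(n-1)] are the coefficients of
   [(1 + 4 X) F (m - 5) F (n - 5)], which is symmetric in [m] and [n].

   Both spectral radii are [4^(1/r)].  Let [a^r = 1/2].  Giving weight [1] to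
   [v_2, ..., v_(N-2)], [a] to the inner vertices of the edges between them and [a^2] to
   the remaining vertices is a positive eigenvector of [W_N] for [a^-2 = 4^(1/r)];
   weight [1] on the [v_i] and [a] elsewhere is a supersolution on a loose path.  The
   Collatz-Wielandt bound then shows that [a^-2] is the radius of the union. *)

Set Implicit Arguments. Unset Strict Implicit. Unset Printing Implicit Defensive.
(* [classical_sets] shadows lemma names of [fintype] and [finset]. *)
Import fintype boot.finset.
Import Order.TTheory GRing.Theory Num.Theory.
Local Open Scope ring_scope.

(** * Matching generating functions *)

Definition matching (V : finType) (S : {set {set V}}) : bool :=
  [forall e in S, forall f in S, (e != f) ==> [disjoint e & f]].

Lemma matchingP (V : finType) (S : {set {set V}}) :
  reflect {in S &, forall e f : {set V}, e != f -> [disjoint e & f]} (matching S).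
Proof.
apply: (iffP forall_inP) => [h e f eS fS | h e eS].
  by move/forall_inP: (h e eS) => /(_ f fS)/implyP.
by apply/forall_inP => f fS; apply/implyP; apply: h.
Qed.

(** Signs and exponents are left out: these coefficients, [hv K] and [r] determine [matching_poly].
    Any edge set on [V] is allowed, so that deleting edges keeps the vertex type. *)
Definition matching_gen (V : finType) (A : {set {set V}}) : {poly int} :=
  \sum_(S : {set {set V}} | (S \subset A) && matching S) 'X^#|S|.

Lemma coef_matching_gen (K : hgraph) k :
  (matching_gen (he K))`_k = (matching_number K k)%:R.
Proof.
rewrite coef_sum /matching_number -sum1_card natr_sum.
under [LHS]eq_bigr do rewrite coefXn.
rewrite (bigID (fun S : {set {set 'I_(hv K)}} => #|S| == k)) /=.
rewrite [X in _ + X]big1 ?addr0; last first.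
  by move=> S /andP[_ /negPf]; rewrite eq_sym => ->.
apply: eq_big => [S|S /andP[_ /eqP->]]; last by rewrite eqxx.
by rewrite inE andbAC.
Qed.

(** Split by whether a matching contains [x]: removing [x] leaves a matching among the edges
    disjoint from [x], and one factor ['X] accounts for [x]. *)
Lemma matching_genU1 (V : finType) (x : {set V}) (A : {set {set V}}) :
  x \notin A ->
  matching_gen (x |: A) =
  matching_gen A + 'X * matching_gen [set y in A | [disjoint x & y]].
Proof.
move=> xA; rewrite /matching_gen (bigID (fun S : {set _} => x \in S)) /= addrC.
congr (_ + _).
  apply: eq_bigl => S; rewrite andbAC; congr (_ && _).
  apply/andP/idP => [[/subsetP sub xS]|/subsetP sub].
    apply/subsetP => y yS; move: (sub y yS); rewrite in_setU1 => /orP[/eqP yx|//].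
    by rewrite -yx yS in xS.
  split; last by apply: contra xA => /sub.
  by apply/subsetP => y /sub; rewrite in_setU1 orbC => ->.
(* The side condition [(x |: S) :\ x == S] of this reindexing encodes [x \notin S]. *)
rewrite big_distrr /= (reindex_onto (fun S => x |: S) (fun S => S :\ x)) /=; last first.
  by move=> S /andP[_ xS]; rewrite setD1K.
apply: eq_big => [S|S /andP[_ /eqP eS]]; last first.
  have xS : x \notin S by rewrite -eS !inE eqxx.
  by rewrite cardsU1 xS -exprS.
apply/idP/idP.
  case/andP=> /andP[/andP[/subsetP sub /matchingP mS] _] /eqP eS.
  have xS : x \notin S by rewrite -eS !inE eqxx.
  apply/andP; split.
    apply/subsetP => y yS.
    have yx : y != x by apply: contraNneq xS => <-.
    have yU : y \in x |: S by rewrite in_setU1 yS orbT.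
    move: (sub y yU); rewrite inE in_setU1 (negPf yx) /= => ->.
    by rewrite mS // ?in_setU1 ?eqxx // eq_sym.
  by apply/matchingP => e f eS' fS'; apply: mS; rewrite in_setU1 ?eS' ?fS' orbT.
case/andP=> /subsetP sub /matchingP mS.
have xS : x \notin S by apply: contra xA => /sub; rewrite inE => /andP[].
rewrite setU1K // eqxx in_setU1 eqxx /= !andbT; apply/andP; split.
  apply/subsetP => y; rewrite !in_setU1 => /orP[->//|/sub].
  by rewrite inE => /andP[-> _]; rewrite orbT.
apply/matchingP => e f; rewrite !in_setU1.
have disjx y : y \in S -> [disjoint x & y].
  by move=> /sub; rewrite inE => /andP[].
case/orP=> [/eqP->|eS]; case/orP=> [/eqP->|fS]; rewrite ?eqxx // => ef.
- exact: disjx.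
- by rewrite disjoint_sym disjx.
- exact: mS.
Qed.

(** A list of edges allows deletion in a chosen order, each deletion being a filter. *)
Definition matching_genl (V : finType) (s : seq {set V}) : {poly int} :=
  matching_gen [set e in s].

Lemma eq_matching_genl (V : finType) (s1 s2 : seq {set V}) :
  s1 =i s2 -> matching_genl s1 = matching_genl s2.
Proof. by move=> h; congr matching_gen; apply/setP => e; rewrite !inE. Qed.

Lemma matching_genl_nil (V : finType) : matching_genl (V := V) [::] = 1.
Proof.
rewrite /matching_genl /matching_gen (big_pred1 set0) ?cards0 ?expr0 //.
move=> S; rewrite /= (_ : [set e in [::]] = set0); last by apply/setP => e; rewrite !inE.
rewrite subset0; case: eqP => //= ->.
by apply/matchingP => e f; rewrite inE.
Qed.

Lemma matching_genl_cons (V : finType) (x : {set V}) (s : seq {set V}) :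
  x \notin s ->
  matching_genl (x :: s) =
  matching_genl s + 'X * matching_genl [seq y : {set V} <- s | [disjoint x & y]].
Proof.
move=> xs; rewrite /matching_genl set_cons matching_genU1 ?inE //.
congr (_ + 'X * matching_gen _).
by apply/setP => y; rewrite !inE mem_filter andbC.
Qed.

Lemma matching_genl_cat (V : finType) (s1 s2 : seq {set V}) :
  uniq (s1 ++ s2) -> {in s1 & s2, forall e f : {set V}, [disjoint e & f]} ->
  matching_genl (s1 ++ s2) = matching_genl s1 * matching_genl s2.
Proof.
(* Deleting an edge filters [s1], so the induction runs on a bound for its size. *)
move: {2}(size s1).+1 (ltnSn (size s1)) => N.
elim: N s1 => // N IH [|x s1] /=; first by rewrite matching_genl_nil mul1r.
rewrite ltnS => le_s /andP[xs us] dis.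
have dis1 : {in s1 & s2, forall e f : {set V}, [disjoint e & f]}.
  by move=> e f es; apply: dis; rewrite inE es orbT.
have f2 : [seq y : {set V} <- s2 | [disjoint x & y]] = s2.
  by apply/all_filterP/allP => y; apply: dis; rewrite inE eqxx.
rewrite !matching_genl_cons //; last by apply: contra xs; rewrite mem_cat => ->.
rewrite filter_cat f2 !IH //.
- by rewrite mulrDl mulrA.
- by rewrite size_filter; apply: leq_ltn_trans (count_size _ _) le_s.
- by rewrite -f2 -filter_cat filter_uniq.
- by move=> e f; rewrite mem_filter => /andP[_]; apply: dis1.
Qed.

Lemma matching_genl_imset (V W : finType) (f : V -> W) (s : seq {set V}) :
  injective f -> uniq s ->
  matching_genl [seq f @: e | e : {set V} <- s] = matching_genl s.
Proof.
move=> inj_f; have inj_im := imset_inj inj_f.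
move: {2}(size s).+1 (ltnSn (size s)) => N.
elim: N s => // N IH [|x s] /=; first by rewrite !matching_genl_nil.
rewrite ltnS => le_s /andP[xs us].
rewrite !matching_genl_cons ?mem_map // filter_map IH //.
rewrite (eq_filter (a2 := fun y : {set V} => [disjoint x & y])); last first.
  by move=> y; rewrite /= imset_disjoint //; exact: in2W.
rewrite IH ?filter_uniq //.
by rewrite size_filter; apply: leq_ltn_trans (count_size _ _) le_s.
Qed.

(** Images of edges from the two sides are disjoint, so matchings combine freely. An empty edge
    could have the same image from both sides; the hypothesis on [set0] excludes this. *)
Lemma matching_gen_hunion (K1 K2 : hgraph) :
  set0 \notin he K1 ->
  matching_gen (he (hunion K1 K2)) = matching_gen (he K1) * matching_gen (he K2).
Proof.
move=> ne0.
have E (V : finType) (A : {set {set V}}) : matching_gen A = matching_genl (enum A).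
  by congr matching_gen; apply/setP => e; rewrite inE mem_enum.
pose f1 := fun e : {set 'I_(hv K1)} => @lshift (hv K1) (hv K2) @: e.
pose f2 := fun e : {set 'I_(hv K2)} => @rshift (hv K1) (hv K2) @: e.
have disj e1 e2 : [disjoint f1 e1 & f2 e2].
  rewrite -setI_eq0; apply/eqP/setP => v; rewrite !inE; apply/negP.
  case/andP=> /imsetP[v1 _ ->] /imsetP[v2 _ /eqP].
  by rewrite eq_lrshift.
have u1 : uniq [seq f1 e | e <- enum (he K1)].
  by rewrite map_inj_uniq ?enum_uniq //; apply: imset_inj; apply: lshift_inj.
have u2 : uniq [seq f2 e | e <- enum (he K2)].
  by rewrite map_inj_uniq ?enum_uniq //; apply: imset_inj; apply: rshift_inj.
rewrite (_ : matching_gen (he (hunion K1 K2)) =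
   matching_genl ([seq f1 e | e <- enum (he K1)] ++ [seq f2 e | e <- enum (he K2)])).
  rewrite matching_genl_cat.
  - by rewrite !matching_genl_imset ?enum_uniq ?E //; [apply: rshift_inj | apply: lshift_inj].
  - rewrite cat_uniq u1 u2 andbT /=; apply/hasPn => _ /mapP[e2 _ ->].
    apply/negP => /mapP[e1]; rewrite mem_enum => e1K eq12.
    have := disj e1 e2; rewrite eq12 -setI_eq0 setIid => /eqP f10.
    move: ne0; rewrite -(_ : e1 = set0) ?e1K //.
    by apply/eqP; rewrite -(imset_eq0 (@lshift (hv K1) (hv K2))) -/(f1 e1) f10.
  - by move=> _ _ /mapP[e1 _ ->] /mapP[e2 _ ->].
congr matching_gen; apply/setP => e; rewrite !inE mem_cat.
by congr (_ || _); apply/imsetP/mapP => -[e' h ->]; exists e'; rewrite ?mem_enum in h *.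
Qed.

(** The pair holds [F t] and [F (t + 1)], which makes the two-step recurrence structural. *)
Fixpoint path_gen2 (t : nat) : {poly int} * {poly int} :=
  if t is t'.+1 then let: (p, q) := path_gen2 t' in (q, q + 'X * p) else (1, 1 + 'X).
Definition path_gen (t : nat) : {poly int} := (path_gen2 t).1.

Lemma path_gen0 : path_gen 0 = 1. Proof. by []. Qed.
Lemma path_gen1 : path_gen 1 = 1 + 'X. Proof. by []. Qed.
Lemma path_genSS t : path_gen t.+2 = path_gen t.+1 + 'X * path_gen t.
Proof. by rewrite /path_gen /=; case: (path_gen2 t). Qed.

(** Delete [E a]: among the later edges only [E a.+1] meets it, so the paths starting at [a.+1] and
    at [a.+2] remain. This is the recurrence of [path_gen], and it is why the starting index is
    free. *)
Lemma matching_genl_path (V : finType) (E : nat -> {set V}) (a t : nat) :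
  (forall i j, a <= i -> i < j -> j < a + t -> E i != E j)%N ->
  (forall i j, a <= i -> i < j -> j < a + t -> [disjoint E i & E j] = (i.+1 < j))%N ->
  matching_genl [seq E j | j <- iota a t] = path_gen t.
Proof.
move: {2}t.+1 (ltnSn t) => N.
elim: N a t => // N IH a [|t] ltN neqE disE; first exact: matching_genl_nil.
rewrite /= matching_genl_cons; last first.
  apply/negP => /mapP[j]; rewrite mem_iota => /andP[aj jt] eE.
  by have /eqP := neqE a j (leqnn _) aj ltac:(lia).
rewrite filter_map (@eq_in_filter _ _ (fun j => a.+1 < j)%N); last first.
  by move=> j; rewrite mem_iota => /andP[aj jt] /=; apply: disE => //; lia.
rewrite IH; [|lia|move=> *; apply: neqE; lia|move=> *; apply: disE; lia].
case: t ltN neqE disE => [|t] ltN neqE disE /=.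
  by rewrite matching_genl_nil path_gen0 path_gen1 mulr1.
rewrite ltnn (_ : [seq j <- iota a.+2 t | (a.+1 < j)%N] = iota a.+2 t); last first.
  by apply/all_filterP/allP => j; rewrite mem_iota => /andP[].
rewrite IH ?path_genSS //; [lia|move=> *; apply: neqE; lia|move=> *; apply: disE; lia].
Qed.

(** Only the intersection pattern matters. [E 0] and [p] meet each other and, among the other edges,
    only [E 1]; [E k.+2] and [q] behave alike at [E k.+1]. Deleting these four edges leaves
    paths. *)
Lemma matching_genl_W (V : finType) (E : nat -> {set V}) (p q : {set V}) (k : nat) :
  (forall i j, i < j -> j < k.+3 -> E i != E j)%N ->
  (forall i j, i < j -> j < k.+3 -> [disjoint E i & E j] = (i.+1 < j))%N ->
  p != q -> (forall j, j < k.+3 -> p != E j)%N -> (forall j, j < k.+3 -> q != E j)%N ->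
  [disjoint p & q] ->
  (forall j, j < k.+3 -> [disjoint p & E j] = (1 < j))%N ->
  (forall j, j < k.+3 -> [disjoint q & E j] = (j < k.+1))%N ->
  matching_genl (p :: q :: [seq E j | j <- iota 0 k.+3]) =
  (1 + 4%:R * 'X) * path_gen k.+1.
Proof.
move=> neqE disE neq_pq neq_pE neq_qE dis_pq dis_pE dis_qE.
have memE i a t : (i < a)%N || (a + t <= i < k.+3)%N -> (a + t <= k.+3)%N ->
    E i \notin [seq E j | j <- iota a t].
  move=> ai atk; apply/negP => /mapP[j]; rewrite mem_iota => aj eE.
  have := neqE i j; have := neqE j i; rewrite eE eqxx; lia.
have memo x a t : (forall j, j < k.+3 -> x != E j)%N -> (a + t <= k.+3)%N ->
    x \notin [seq E j | j <- iota a t].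
  move=> xE atk; apply/negP => /mapP[j]; rewrite mem_iota => aj eE.
  by have /eqP := xE j ltac:(lia).
have path a t : (a + t <= k.+3)%N -> matching_genl [seq E j | j <- iota a t] = path_gen t.
  by move=> atk; apply: matching_genl_path => i j *; [apply: neqE | apply: disE]; lia.
have filt (x : {set V}) a t (P : pred nat) : (a + t <= k.+3)%N ->
    (forall j, (a <= j < k.+3)%N -> (j < a + t)%N -> [disjoint x & E j] = P j) ->
    [seq y : {set V} <- [seq E j | j <- iota a t] | [disjoint x & y]] =
    [seq E j | j <- [seq j <- iota a t | P j]].
  move=> atk xP; rewrite filter_map; congr map; apply: eq_in_filter => j.
  by rewrite mem_iota => aj; apply: xP; lia.
(* Each right end edge excludes the other one and [E k.+1], the last edge of the middle path. At
   [b = 0] the truncated [b.-1] is [0], which realises [F (-1) = 1]. *)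
have right_end a b : (0 < a)%N -> (a + b = k.+2)%N ->
    matching_genl [:: E k.+2, q & [seq E j | j <- iota a b]] =
    path_gen b + 2%:R * 'X * path_gen b.-1.
  move=> a_gt0 abk.
  have fr : [seq j <- iota a b | (j < k.+1)%N] = iota a b.-1.
    case: b abk => [|b] abk //; rewrite -[b.+1]addn1 iotaD filter_cat /= addn1 /=.
    rewrite (_ : (a + b < k.+1)%N = false) ?cats0; last by lia.
    by apply/all_filterP/allP => j; rewrite mem_iota; lia.
  rewrite matching_genl_cons; last first.
    by rewrite inE eq_sym negb_or neq_qE // memE //; lia.
  rewrite matching_genl_cons ?memo //; last by lia.
  rewrite /= disjoint_sym dis_qE // ltnNge leqW //=.
  rewrite (filt q _ _ (fun j => j < k.+1)%N) => [| |j aj _]; [|lia|apply: dis_qE; lia].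
  rewrite (filt (E k.+2) _ _ (fun j => j < k.+1)%N) => [| |j aj ajk]; [|lia|]; last first.
    by rewrite disjoint_sym disE //; lia.
  rewrite fr !path; try lia.
  by ring.
have fl : [seq j <- iota 1 k.+1 | (1 < j)%N] = iota 2 k.
  by rewrite /=; apply/all_filterP/allP => j; rewrite mem_iota; lia.
have f0 : [seq y : {set V} <- [seq E j | j <- iota 1 k.+1] | [disjoint E 0 & y]] =
    [seq E j | j <- iota 2 k].
  rewrite (filt (E 0) 1%N k.+1 (fun j => 1 < j)%N) ?fl // => j aj _.
  by apply: disE; lia.
have fp : [seq y : {set V} <- [seq E j | j <- iota 1 k.+1] | [disjoint p & y]] =
    [seq E j | j <- iota 2 k].
  rewrite (filt p 1%N k.+1 (fun j => 1 < j)%N) ?fl // => j aj _.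
  by apply: dis_pE; lia.
have E0M : E 0 \notin [seq E j | j <- iota 1 k.+1] by apply: memE.
have pM : p \notin [seq E j | j <- iota 1 k.+1] by apply: memo.
have right1 := right_end 1%N k.+1 isT erefl.
(* Only the set of edges counts, so the four end edges may be moved to the front. *)
have -> : matching_genl (p :: q :: [seq E j | j <- iota 0 k.+3]) =
    matching_genl [:: E 0, p, E k.+2, q & [seq E j | j <- iota 1 k.+1]].
  apply: eq_matching_genl => x.
  rewrite -[k.+3]addn1 iotaD map_cat /= !inE mem_cat !inE.
  by do ![case: eqP => //= _]; rewrite ?orbT ?orbF.
set M := [seq E j | j <- iota 1 k.+1] in f0 fp E0M pM right1 *; clearbody M.
rewrite matching_genl_cons; last first.
  by rewrite !inE !negb_or (eq_sym _ p) (eq_sym _ q) E0M neq_pE // neq_qE // neqE.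
rewrite matching_genl_cons; last by rewrite !inE !negb_or pM neq_pq neq_pE.
rewrite /= (disjoint_sym (E 0) p) dis_pE //= disE //= dis_pE //= dis_pq.
rewrite (disjoint_sym (E 0)) dis_qE //= f0 fp right1 right_end //.
(* The factorisation uses [F (-1) = 1] when [k = 0], and the recurrence for [F (k + 1)]
   otherwise. *)
case: (k) => [|l] /=; last rewrite path_genSS; rewrite ?path_gen0 ?path_gen1; ring.
Qed.

(** * Edges of loose paths and of [W_N] *)

(** The ambient size [n] is free, so that the same edges serve a loose path and the path inside
    [W_N]. *)
Definition seg (n s j : nat) : {set 'I_n} := [set v : 'I_n | (j * s <= v <= j.+1 * s)%N].

Lemma seg_neq (n s i j : nat) : (0 < s)%N -> (i < j)%N -> (j * s < n)%N ->
  seg n s i != seg n s j.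
Proof.
move=> s_gt0 ij jn; have ijs : (i * s < j * s)%N by rewrite ltn_pmul2r.
(* The vertex [i * s] starts edge [i] and comes before edge [j]. *)
apply/eqP => /setP /(_ (Ordinal (ltn_trans ijs jn))).
by rewrite !inE /= leqnn leq_pmul2r // leqnSn leqNgt ijs.
Qed.

Lemma seg_disjoint (n s i j : nat) : (0 < s)%N -> (i < j)%N -> (j * s < n)%N ->
  [disjoint seg n s i & seg n s j] = (i.+1 < j)%N.
Proof.
move=> s_gt0 ij jn; rewrite -setI_eq0; apply/eqP/idP => [/setP h | ij1].
  rewrite ltnNge; apply/negP => ji; have eji : j = i.+1 by lia.
  (* Consecutive edges share the vertex [j * s]. *)
  have := h (Ordinal jn); rewrite !inE /= eji !leq_pmul2r //; lia.
apply/setP => v; rewrite !inE; apply/negP => /andP[/andP[_ vi] /andP[jv _]].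
by move: (leq_trans jv vi); rewrite leq_pmul2r // leqNgt ij1.
Qed.

Lemma card_itv (n a b : nat) : (b <= n)%N -> #|[set v : 'I_n | a <= v < b]%N| = (b - a)%N.
Proof.
move=> bn; rewrite -sum1_card (eq_bigl (fun v : 'I_n => (v < b) && (a <= v))%N); last first.
  by move=> v; rewrite inE andbC.
rewrite -(big_geq_mkord a n (fun v => true && (v < b)%N) (fun=> 1%N)).
by rewrite -(big_nat_widen a b n xpredT) // sum_nat_const_nat muln1.
Qed.

Lemma card_seg (n s j : nat) : (j.+1 * s < n)%N -> #|seg n s j| = s.+1.
Proof. by move=> /card_itv jn; rewrite jn mulSn addnC -addnS addKn. Qed.

(** Convertible to [loose_path r t] when [s] is [r - 1]. *)
Definition path_seg (s t : nat) : hgraph :=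
  @HG (t * s).+1 [set seg (t * s).+1 s j | j : 'I_t].

(* Here [s = r - 1] and [N = k + 5], so that the path of [W_N] has [k + 3] edges. *)
Definition W_size (s k : nat) : nat := ((k.+3 * s).+1 + 2 * s)%N.

Definition pend_l (s k : nat) : {set 'I_(W_size s k)} :=
  [set v : 'I_(W_size s k) |
    (v == s :> nat) || ((k.+3 * s).+1 <= v < (k.+3 * s).+1 + s)%N].

Definition pend_r (s k : nat) : {set 'I_(W_size s k)} :=
  [set v : 'I_(W_size s k) |
    (v == (k.+2 * s)%N :> nat) || ((k.+3 * s).+1 + s <= v < W_size s k)%N].

Definition W_seg (s k : nat) : hgraph := @HG (W_size s k)
  ([set seg (W_size s k) s j | j : 'I_k.+3] :|: [set pend_l s k; pend_r s k]).

Lemma W_graphE (r k : nat) : W_graph r (k + 5) = W_seg (r - 1) k.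
Proof.
rewrite /W_graph.
have -> : (k + 5 - 2 = k.+3)%N by lia.
by have -> : (k + 5 - 3 = k.+2)%N by lia.
Qed.

Lemma seg_lt (n s j t : nat) (v : 'I_n) :
  (j < t)%N -> v \in seg n s j -> (v < (t * s).+1)%N.
Proof.
move=> jt; rewrite inE => /andP[_ vj]; rewrite ltnS (leq_trans vj) //.
by rewrite leq_mul2r jt orbT.
Qed.

(** The first new vertex of the pendent edge lies beyond every path vertex. *)
Lemma pend_l_neq_seg (s k j : nat) : (0 < s)%N -> (j < k.+3)%N ->
  pend_l s k != seg (W_size s k) s j.
Proof.
move=> s_gt0 jk; have vW : ((k.+3 * s).+1 < W_size s k)%N by rewrite /W_size; lia.
apply/eqP => /setP /(_ (Ordinal vW)) pE.
have := @seg_lt _ s j _ (Ordinal vW) jk; rewrite -pE inE /=; lia.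
Qed.

Lemma pend_r_neq_seg (s k j : nat) : (0 < s)%N -> (j < k.+3)%N ->
  pend_r s k != seg (W_size s k) s j.
Proof.
move=> s_gt0 jk; have vW : ((k.+3 * s).+1 + s < W_size s k)%N by rewrite /W_size; lia.
apply/eqP => /setP /(_ (Ordinal vW)) pE.
have := @seg_lt _ s j _ (Ordinal vW) jk; rewrite -pE inE /W_size /=; lia.
Qed.

Lemma pend_neq (s k : nat) : (0 < s)%N -> pend_l s k != pend_r s k.
Proof.
move=> s_gt0; have vW : ((k.+3 * s).+1 < W_size s k)%N by rewrite /W_size; lia.
apply/eqP => /setP /(_ (Ordinal vW)); rewrite !inE /= leqnn; lia.
Qed.

Lemma card_pend_l (s k : nat) : (0 < s)%N -> #|pend_l s k| = s.+1.
Proof.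
move=> s_gt0; have vW : (s < W_size s k)%N by rewrite /W_size; lia.
have -> : pend_l s k = Ordinal vW |:
    [set v : 'I_(W_size s k) | (k.+3 * s).+1 <= v < (k.+3 * s).+1 + s]%N.
  by apply/setP => v; rewrite !inE.
rewrite cardsU1 card_itv ?addKn ?inE /=; last by rewrite /W_size; lia.
by rewrite (_ : _ <= s = false)%N //; lia.
Qed.

Lemma card_pend_r (s k : nat) : (0 < s)%N -> #|pend_r s k| = s.+1.
Proof.
move=> s_gt0; have vW : (k.+2 * s < W_size s k)%N by rewrite /W_size; lia.
have -> : pend_r s k = Ordinal vW |:
    [set v : 'I_(W_size s k) | (k.+3 * s).+1 + s <= v < W_size s k]%N.
  by apply/setP => v; rewrite !inE.
rewrite cardsU1 card_itv // inE /=.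
rewrite (_ : _ <= k.+2 * s = false)%N /W_size; lia.
Qed.

(** * Matching numbers of loose paths, of [W_N] and of their unions *)

Lemma matching_gen_loose_path (r t : nat) : (1 < r)%N ->
  matching_gen (he (loose_path r t)) = path_gen t.
Proof.
move=> r_gt1; have s_gt0 : (0 < r - 1)%N by lia.
have lt_n j : (j < 0 + t)%N -> (j * (r - 1) < (t * (r - 1)).+1)%N.
  by move=> jt; rewrite ltnS leq_pmul2r //; lia.
rewrite -(@matching_genl_path _ (seg (t * (r - 1)).+1 (r - 1)) 0 t).
- congr matching_gen; apply/setP => e; rewrite inE.
  apply/imsetP/mapP => [[j _ ->]|[j]].
    by exists (val j); rewrite // mem_iota /= add0n.
  by rewrite mem_iota /= add0n => jt ->; exists (Ordinal jt).
- by move=> i j _ ij jt; apply: seg_neq => //; apply: lt_n.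
- by move=> i j _ ij jt; apply: seg_disjoint => //; apply: lt_n.
Qed.

Lemma set0_notin_loose_path (r t : nat) : set0 \notin he (loose_path r t).
Proof.
apply/imsetP => -[j _ /setP].
have jt : (j * (r - 1) < (t * (r - 1)).+1)%N by rewrite ltnS leq_mul2r ltnW ?orbT.
by move/(_ (Ordinal jt)); rewrite !inE /= leqnn leq_mul2r leqnSn orbT.
Qed.

Lemma matching_gen_W_graph (r k : nat) : (1 < r)%N ->
  matching_gen (he (W_graph r (k + 5))) = (1 + 4%:R * 'X) * path_gen k.+1.
Proof.
move=> r_gt1; rewrite W_graphE /=.
set s := (r - 1)%N; have s_gt0 : (0 < s)%N by rewrite /s; lia.
have ltn_n j : (j < k.+3)%N -> (j * s < W_size s k)%N.
  by move=> jk; apply: (@ltn_trans (k.+3 * s)%N); rewrite ?ltn_pmul2r // /W_size; lia.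
rewrite -(@matching_genl_W _ (seg _ s) (pend_l s k) (pend_r s k) k).
- congr matching_gen; apply/setP => e.
  rewrite in_setU in_set2 inE 2!in_cons orbC -orbA; congr [|| _, _ | _].
  apply/imsetP/mapP => [[j _ ->]|[j]].
    by exists (val j); rewrite // mem_iota /= add0n.
  by rewrite mem_iota /= add0n => jt ->; exists (Ordinal jt).
- by move=> i j ij jk; apply: seg_neq => //; apply: ltn_n.
- by move=> i j ij jk; apply: seg_disjoint => //; apply: ltn_n.
- exact: pend_neq.
- by move=> j; apply: pend_l_neq_seg.
- by move=> j; apply: pend_r_neq_seg.
- by rewrite -setI_eq0; apply/eqP/setP => v; rewrite !inE; nia.
(* The vertex [s] is [v_2], common to path edges [0] and [1]; the new vertices of [pend_l] lie on no
   path edge. *)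
- move=> j jk; rewrite -setI_eq0; apply/eqP/idP => [/setP h|j_gt1].
    have sn : (s < W_size s k)%N by rewrite /W_size; lia.
    move: (h (Ordinal sn)); rewrite !inE /= eqxx /= -{2 3}[s]mul1n !leq_pmul2r //; lia.
  apply/setP => v; rewrite in_setI in_set0; apply/negP => /andP[vp vj].
  have := seg_lt jk vj; move: vp vj; rewrite !inE; nia.
(* Likewise [k.+2 * s] is [v_(N-2)], common to path edges [k.+1] and [k.+2]. *)
- move=> j jk; rewrite -setI_eq0; apply/eqP/idP => [/setP h|j_gt1].
    have sn : (k.+2 * s < W_size s k)%N by apply: ltn_n.
    move: (h (Ordinal sn)); rewrite !inE /= eqxx /= !leq_pmul2r //; lia.
  apply/setP => v; rewrite in_setI in_set0; apply/negP => /andP[vp vj].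
  have := seg_lt jk vj; move: vp vj; rewrite !inE; nia.
Qed.

(** The count depends only on [t + k], so the exchange of parameters preserves the exponents of
    [matching_poly]. *)
Lemma hv_hunion_path_W (r t k : nat) :
  hv (hunion (loose_path r t) (W_graph r (k + 5))) = ((t + k + 5) * (r - 1)).+2.
Proof.
by rewrite /= (_ : k + 5 - 2 = k.+3)%N; [nia | lia].
Qed.

Lemma matching_number_path_W_sym (r t k i : nat) : (1 < r)%N ->
  matching_number (hunion (loose_path r t.+1) (W_graph r (k + 5))) i =
  matching_number (hunion (loose_path r k.+1) (W_graph r (t + 5))) i.
Proof.
move=> r_gt1; apply/eqP; rewrite -(eqr_nat int) -!coef_matching_gen; apply/eqP.
congr (_ `_ _); congr polyseq; rewrite !matching_gen_hunion ?set0_notin_loose_path //.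
by rewrite !matching_gen_loose_path // !matching_gen_W_graph //; ring.
Qed.

(** The two matching polynomials are equal, so their root lists are the same and no root is
    computed. *)
Lemma matching_energy_path_W_sym (R : realType) (r t k : nat) : (1 < r)%N ->
  matching_energy R r (hunion (loose_path r t.+1) (W_graph r (k + 5))) =
  matching_energy R r (hunion (loose_path r k.+1) (W_graph r (t + 5))).
Proof.
move=> r_gt1; rewrite /matching_energy; congr (\sum_(z <- poly_roots _) _).
rewrite /matching_poly !hv_hunion_path_W (_ : t.+1 + k + 5 = k.+1 + t + 5)%N; last lia.
by apply: eq_bigr => i _; rewrite matching_number_path_W_sym.
Qed.

(** * Eigenvalues of the adjacency tensor *)

Definition uniform (r : nat) (K : hgraph) := forall e, e \in he K -> #|e| = r.

(** For an [r]-uniform hypergraph this is coordinate [i] of the adjacency tensor applied to [x]. The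
    ring is general because both real weights and complex vectors occur. *)
Definition edge_sum (A : comNzRingType) (K : hgraph) (x : 'I_(hv K) -> A)
    (i : 'I_(hv K)) : A :=
  \sum_(e in he K | i \in e) \prod_(v in e :\ i) x v.

(** Since [e :\ i] has [s] elements, [s] entries that cover it hit each element exactly once. Tuples
    are thereby counted as injections. *)
Lemma setU1_codom_eq (V : finType) (s : nat) (e : {set V}) (i : V) (t : {ffun 'I_s -> V}) :
  #|e| = s.+1 -> i \in e ->
  (i |: [set t j | j : 'I_s] == e) =
  (t \in [set f : {ffun 'I_s -> V} in ffun_on (mem (e :\ i)) | injectiveb f]).
Proof.
move=> card_e ie; have card_ei : #|e :\ i| = s by move: (cardsD1 i e); rewrite ie card_e; lia.
rewrite inE; apply/eqP/andP => [ite | [/ffun_onP t_on /injectiveP t_inj]].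
  have sub : e :\ i \subset [set t j | j : 'I_s].
    by rewrite -ite; apply/subsetP => v; rewrite !inE => /andP[/negPf->].
  have card_im : (#|[set t j | j : 'I_s]| <= s)%N.
    by rewrite -[leqRHS]card_ord leq_imset_card.
  have eq_im : e :\ i = [set t j | j : 'I_s] by apply/eqP; rewrite eqEcard sub card_ei.
  have /imset_injP t_inj : #|[set t j | j : 'I_s]| == #|'I_s|.
    by rewrite -eq_im card_ei card_ord.
  split; last by apply/injectiveP => j k; apply: t_inj.
  by apply/ffun_onP => j; rewrite eq_im imset_f.
have -> : [set t j | j : 'I_s] = e :\ i.
  apply/eqP; rewrite eqEcard card_imset // card_ei card_ord leqnn andbT.
  by apply/subsetP => _ /imsetP[j _ ->].
exact: setD1K.
Qed.

(** An edge through [i] comes from [(r-1)!] tuples, the orderings of its other vertices; this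
    cancels the factor in [adj_entry]. *)
Lemma tensor_sumE (R : realType) (r : nat) (K : hgraph) (x : 'I_(hv K) -> R[i])
    (i : 'I_(hv K)) :
  (0 < r)%N -> uniform r K ->
  \sum_(t : {ffun 'I_r.-1 -> 'I_(hv K)}) adj_entry R i t * \prod_(j : 'I_r.-1) x (t j) =
  edge_sum x i.
Proof.
move=> r_gt0 uniK; pose ed (t : {ffun 'I_r.-1 -> 'I_(hv K)}) := i |: [set t j | j : 'I_r.-1].
transitivity (\sum_(t : {ffun 'I_r.-1 -> 'I_(hv K)} | ed t \in he K)
    (r.-1)`!%:R^-1 * \prod_(j : 'I_r.-1) x (t j)).
  rewrite [RHS]big_mkcond; apply: eq_bigr => t _.
  by rewrite /adj_entry -/(ed t); case: ifP => _; rewrite ?mul0r.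
rewrite (partition_big ed (mem (he K))) //= /edge_sum [RHS]big_mkcondr /=.
apply: eq_bigr => e eK; case: ifP => ie; last first.
  rewrite big_pred0 // => t; apply: contraFF ie => /andP[_ /eqP<-].
  by rewrite /ed setU11.
have card_e : #|e| = r.-1.+1 by rewrite (uniK e) // prednK.
have card_ei : #|e :\ i| = r.-1 by move: (cardsD1 i e); rewrite ie card_e; lia.
rewrite (eq_big (fun t : {ffun 'I_r.-1 -> 'I_(hv K)} =>
     t \in [set f : {ffun 'I_r.-1 -> 'I_(hv K)} in ffun_on (mem (e :\ i)) | injectiveb f])
   (fun _ => (r.-1)`!%:R^-1 * \prod_(v in e :\ i) x v)); first last.
- move=> t /andP[_]; rewrite setU1_codom_eq // inE => /andP[/ffun_onP t_on /injectiveP t_inj].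
  congr (_ * _); have -> : e :\ i = [set t j | j : 'I_r.-1].
    apply/eqP; rewrite eq_sym eqEcard card_imset // card_ei card_ord leqnn andbT.
    by apply/subsetP => _ /imsetP[j _ ->].
  by rewrite big_imset //=; apply: in2W.
- move=> t; rewrite -setU1_codom_eq // -/(ed t).
  by case: (eqVneq (ed t) e) => [->|]; rewrite ?andbF ?andbT.
rewrite sumr_const card_inj_ffuns_on card_ord card_ei ffactnn.
by rewrite -[LHS]mulr_natl mulVKf // pnatr_eq0 -lt0n fact_gt0.
Qed.

Lemma tensor_eigenvalueE (R : realType) (r : nat) (K : hgraph) (lambda : R[i]) :
  (0 < r)%N -> uniform r K ->
  tensor_eigenvalue r K lambda <->
  exists x : {ffun 'I_(hv K) -> R[i]}, x != 0 /\
    forall i, edge_sum x i = lambda * x i ^+ r.-1.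
Proof.
by move=> r_gt0 uniK; split=> -[x [x_neq0 ex]]; exists x; split=> // i;
  rewrite -ex ?(tensor_sumE x).
Qed.

(** Products over whole edges no longer depend on [i], so checking a weight vector takes a single
    value per edge. *)
Lemma edge_sumM (A : comNzRingType) (K : hgraph) (x : 'I_(hv K) -> A) (i : 'I_(hv K)) :
  x i * edge_sum x i = \sum_(e in he K | i \in e) \prod_(v in e) x v.
Proof.
rewrite mulr_sumr; apply: eq_bigr => e /andP[_ ie].
rewrite [RHS](bigD1 i) //=; congr (_ * _); apply: eq_bigl => v.
by rewrite !inE andbC.
Qed.

(** * Moduli of eigenvalues and disjoint unions *)

Lemma normc_sum (R : realType) (I : Type) (s : seq I) (P : pred I) (F : I -> R[i]) :
  Normc.normc (\sum_(i <- s | P i) F i) <= \sum_(i <- s | P i) Normc.normc (F i).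
Proof.
elim/big_ind2: _ => [|a b c d ab cd|//]; first by rewrite Normc.normc0.
by apply: le_trans (le_normcD _ _) _; apply: lerD.
Qed.

Lemma normc_prod (R : realType) (I : Type) (s : seq I) (P : pred I) (F : I -> R[i]) :
  Normc.normc (\prod_(i <- s | P i) F i) = \prod_(i <- s | P i) Normc.normc (F i).
Proof. exact: (big_morph _ (@Normc.normcM R) (Normc.normc1 R)). Qed.

Lemma normcX (R : realType) (x : R[i]) n : Normc.normc (x ^+ n) = Normc.normc x ^+ n.
Proof. by elim: n => [|n IH]; rewrite ?Normc.normc1 // !exprS Normc.normcM IH. Qed.

(* Collatz-Wielandt bound: compare [x] with [z] at a vertex maximising [|x_i| / z_i]. *)
Lemma tensor_eigenvalue_le (R : realType) (r : nat) (K : hgraph) (rho : R)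
    (z : 'I_(hv K) -> R) (lambda : R[i]) :
  (0 < r)%N -> uniform r K -> (forall i, 0 < z i) ->
  (forall i, edge_sum z i <= rho * z i ^+ r.-1) ->
  tensor_eigenvalue r K lambda -> Normc.normc lambda <= rho.
Proof.
move=> r_gt0 uniK z_gt0 z_sup /tensor_eigenvalueE[//|//|x [x_neq0 ex]].
have [i0 xi0] : exists i0, x i0 != 0.
  apply/existsP; rewrite -negb_forall; apply: contra x_neq0 => /forallP x0.
  by apply/eqP/ffunP => i; rewrite ffunE; apply/eqP.
have normc_gt0 (y : R[i]) : y != 0 -> 0 < Normc.normc y.
  rewrite -normr_gt0; by rewrite normc_def ltcR; case: y.
have normc_ge0 (y : R[i]) : 0 <= Normc.normc y.
  by have [->|/normc_gt0/ltW//] := eqVneq y 0; rewrite Normc.normc0.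
have [i _ imax] := @arg_maxP _ _ _ i0 xpredT (fun i => Normc.normc (x i) / z i) isT.
set c := Normc.normc (x i) / z i in imax.
have c_gt0 : 0 < c.
  by apply: lt_le_trans (imax i0 isT); rewrite divr_gt0 // normc_gt0.
have xle v : Normc.normc (x v) <= c * z v by rewrite -ler_pdivrMr //; apply: imax.
have xi : Normc.normc (x i) = c * z i by rewrite /c divfK // gt_eqF.
clearbody c.
have P_gt0 : 0 < (c * z i) ^+ r.-1 by rewrite exprn_gt0 // mulr_gt0.
rewrite -(ler_pM2r P_gt0) -[in leLHS]xi -normcX -Normc.normcM -ex.
apply: le_trans (normc_sum _ _ _) _.
(* Each product has [r.-1] factors, and each factor satisfies [|x_v| <= c z_v] by maximality. *)
apply: (@le_trans _ _ (c ^+ r.-1 * edge_sum z i)); last first.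
  by rewrite exprMn mulrCA ler_wpM2l ?z_sup // exprn_ge0 // ltW.
rewrite mulr_sumr; apply: ler_sum => e /andP[eK ie].
rewrite normc_prod.
have card_ei : #|e :\ i| = r.-1 by rewrite -(uniK e eK) (cardsD1 i e) ie.
rewrite -card_ei -prodr_const -big_split /=.
by apply: ler_prod => v _; rewrite xle normc_ge0.
Qed.

(** An edge sum involves only edges through its vertex, so edges need to correspond only there. This
    serves both embeddings into a disjoint union. *)
Lemma edge_sum_embed (A : comNzRingType) (K K' : hgraph) (f : 'I_(hv K) -> 'I_(hv K'))
    (x : 'I_(hv K') -> A) (i : 'I_(hv K)) :
  injective f ->
  (forall e : {set 'I_(hv K')}, f i \in e ->
     (e \in he K') = (e \in [set f @: d | d : {set _} in he K])) ->
  edge_sum x (f i) = edge_sum (x \o f) i.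
Proof.
move=> f_inj he_f; rewrite /edge_sum.
transitivity (\sum_(e in [set f @: d | d : {set _} in he K] | f i \in e)
    \prod_(v in e :\ f i) x v).
  by apply: eq_bigl => e; case ie: (f i \in e); rewrite ?andbF ?andbT ?he_f.
rewrite big_imset_cond /=; last by move=> d d' _ _; apply: imset_inj.
apply: eq_big => d; first by rewrite mem_imset.
move=> _; have -> : f @: d :\ f i = f @: (d :\ i).
  apply/setP => v; rewrite in_setD1; apply/andP/imsetP => [[vi /imsetP[u ud v_fu]]|[u]].
    by exists u; rewrite // in_setD1 ud andbT; apply: contraNneq vi => <-; rewrite v_fu.
  by rewrite in_setD1 => /andP[ui ud] ->; rewrite (inj_eq f_inj) imset_f.
by rewrite big_imset //; apply: in2W.
Qed.

Lemma edge_sum_hunion_l (A : comNzRingType) (K1 K2 : hgraph)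
    (x : 'I_(hv (hunion K1 K2)) -> A) (i : 'I_(hv K1)) :
  edge_sum x (lshift (hv K2) i) = edge_sum (K := K1) (x \o @lshift (hv K1) (hv K2)) i.
Proof.
apply: edge_sum_embed => [|e ie]; first exact: lshift_inj.
rewrite in_setU [X in _ || X](_ : _ = false) ?orbF //.
apply/imsetP => -[d _ e_d]; move: ie; rewrite e_d => /imsetP[v _ /eqP].
by rewrite eq_lrshift.
Qed.

Lemma edge_sum_hunion_r (A : comNzRingType) (K1 K2 : hgraph)
    (x : 'I_(hv (hunion K1 K2)) -> A) (i : 'I_(hv K2)) :
  edge_sum x (rshift (hv K1) i) = edge_sum (K := K2) (x \o @rshift (hv K1) (hv K2)) i.
Proof.
apply: edge_sum_embed => [|e ie]; first exact: rshift_inj.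
rewrite in_setU [X in X || _](_ : _ = false) //.
apply/imsetP => -[d _ e_d]; move: ie; rewrite e_d => /imsetP[v _ /eqP].
by rewrite eq_rlshift.
Qed.

Lemma uniform_hunion (r : nat) (K1 K2 : hgraph) :
  uniform r K1 -> uniform r K2 -> uniform r (hunion K1 K2).
Proof.
move=> uni1 uni2 _ /setUP[] /imsetP[e eK ->]; rewrite card_imset.
- exact: uni1.
- exact: lshift_inj.
- exact: uni2.
- exact: rshift_inj.
Qed.

(** Gluing [z1] and [z2] gives a positive supersolution on the union, which bounds all eigenvalues;
    [z2] extended by zero is an eigenvector for [rho] itself. *)
Lemma spectral_radius_hunion (R : realType) (r : nat) (K1 K2 : hgraph) (rho : R)
    (z1 : 'I_(hv K1) -> R) (z2 : 'I_(hv K2) -> R) :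
  (1 < r)%N -> uniform r K1 -> uniform r K2 -> (0 < hv K2)%N ->
  (forall i, 0 < z1 i) -> (forall i, 0 < z2 i) -> 0 <= rho ->
  (forall i, edge_sum z1 i <= rho * z1 i ^+ r.-1) ->
  (forall i, edge_sum z2 i = rho * z2 i ^+ r.-1) ->
  spectral_radius R r (hunion K1 K2) = rho.
Proof.
move=> r_gt1 uni1 uni2 hv2 z1_gt0 z2_gt0 rho_ge0 z1_sup z2_eig.
have uni := uniform_hunion uni1 uni2; have r_gt0 := ltnW r_gt1.
have ub lam : tensor_eigenvalue r (hunion K1 K2) lam -> Normc.normc lam <= rho.
  apply: (@tensor_eigenvalue_le _ _ (hunion K1 K2) rho
    (fun i => match split i with inl i1 => z1 i1 | inr i2 => z2 i2 end)) => // i.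
    by case: (split i).
  rewrite -(splitK i); case: (split i) => j /=.
    rewrite edge_sum_hunion_l -/(unsplit (inl j)) unsplitK.
    apply: le_trans (z1_sup j); rewrite le_eqVlt; apply/orP; left; apply/eqP.
    apply: eq_bigr => e _; apply: eq_bigr => v _.
    by rewrite /= -/(unsplit (inl v)) unsplitK.
  rewrite edge_sum_hunion_r -/(unsplit (inr j)) unsplitK -z2_eig.
  rewrite le_eqVlt; apply/orP; left; apply/eqP.
  apply: eq_bigr => e _; apply: eq_bigr => v _.
  by rewrite /= -/(unsplit (inr v)) unsplitK.
have eig : tensor_eigenvalue r (hunion K1 K2) (rho%:C)%C.
  apply/tensor_eigenvalueE => //.
  exists [ffun i => match split i with inl i1 => 0 | inr i2 => ((z2 i2)%:C)%C end].
  split.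
    apply/eqP => /ffunP /(_ (rshift (hv K1) (Ordinal hv2))); rewrite !ffunE.
    rewrite -/(unsplit (inr (Ordinal hv2))) unsplitK => /complexI/eqP.
    by rewrite gt_eqF.
  move=> i; rewrite ffunE -(splitK i); case: (split i) => j /=.
    (* On [K1] both sides vanish: [r.-1] is positive, and each edge through [j] has a further
       vertex, where the vector is zero. *)
    rewrite edge_sum_hunion_l -/(unsplit (inl j)) unsplitK expr0n.
    rewrite (_ : (r.-1 == 0)%N = false) ?mulr0; last by lia.
    rewrite /edge_sum big1 // => e /andP[eK je].
    have : (0 < #|e :\ j|)%N.
      by move: r_gt1; rewrite -(uni1 e eK) (cardsD1 j e) je ltnS.
    case/card_gt0P => v ve; rewrite (bigD1 v) //= ffunE.
    by rewrite -/(unsplit (inl v)) unsplitK mul0r.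
  rewrite edge_sum_hunion_r -/(unsplit (inr j)) unsplitK -rmorphXn -rmorphM -z2_eig.
  rewrite rmorph_sum; apply: eq_bigr => e _; rewrite rmorph_prod; apply: eq_bigr => v _.
  by rewrite /= ffunE -/(unsplit (inr v)) unsplitK.
have nrho : Normc.normc (rho%:C)%C = rho.
  by rewrite /= expr0n /= addr0 sqrtr_sqr ger0_norm.
rewrite /spectral_radius; set S := (X in sup X).
have Srho : S rho by exists (rho%:C)%C.
have ubS : ubound S rho by move=> _ [lam /ub le_lam <-].
apply/eqP; rewrite eq_le; apply/andP; split.
  by apply: ge_sup => //; exists rho.
by apply: ub_le_sup => //; exists rho.
Qed.

(** * Weights on loose paths and on [W_N] *)

Lemma mem_seg (n s j : nat) (i : 'I_n) : (0 < s)%N ->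
  (i \in seg n s j) = [|| j == i %/ s | (s %| i) && (j.+1 == i %/ s)]%N.
Proof.
move=> s_gt0; rewrite inE -leq_divRL //.
have := divn_eq i s; have := ltn_pmod i s_gt0; rewrite /dvdn.
move: (i %/ s)%N (i %% s)%N => q c cs ->; rewrite mulSn.
have [->|neq_jq] /= := eqVneq j q; first by nia.
have [<-|neq_jq1] := eqVneq j.+1 q; last by nia.
by rewrite mulSn; lia.
Qed.

Lemma sum_seg (M : nmodType) (n s t : nat) (i : 'I_n) (g : nat -> M) : (0 < s)%N ->
  \sum_(j < t | i \in seg n s j) g j =
  (if (i %/ s < t)%N then g (i %/ s)%N else 0) +
  (if [&& s %| i, 0 < i %/ s & i %/ s <= t]%N then g (i %/ s).-1%N else 0).
Proof.
move=> s_gt0; rewrite (bigID (fun j : 'I_t => j == i %/ s :> nat)%N) /=; congr (_ + _).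
  rewrite (eq_bigl (fun j : 'I_t => j == i %/ s :> nat)%N) ?big_ord1_eq // => j.
  by rewrite mem_seg //; case: eqP; rewrite ?andbF.
transitivity (\sum_(j < t | (s %| i)%N && (j.+1 == i %/ s)%N) g j).
  apply: eq_bigl => j; rewrite mem_seg //.
  by case: eqP => [->|] /=; rewrite ?andbT // -[X in _ == X]addn0 -addn1 eqn_add2l !andbF.
case: (s %| i)%N => /=; last by rewrite big_pred0.
case: (i %/ s)%N => [|q]; first by rewrite big_pred0.
by rewrite (big_ord1_eq +%R).
Qed.

(** The bound amounts to [(t - 1) * s < n]: each edge has its first vertex, so distinct indices give
    distinct edges. *)
Lemma sum_segs (M : nmodType) (n s t : nat) (i : 'I_n) (F : {set 'I_n} -> M) :
  (0 < s)%N -> (t * s < n + s)%N ->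
  \sum_(e in [set seg n s j | j : 'I_t] | i \in e) F e =
  \sum_(j < t | i \in seg n s j) F (seg n s j).
Proof.
move=> s_gt0 tn; rewrite big_imset_cond //= => j l _ _ /eqP eq_seg.
have lt_n (m : 'I_t) : (m * s < n)%N.
  by have := leq_mul (ltn_ord m) (leqnn s); rewrite mulSn; lia.
apply: val_inj; case: (ltngtP j l) => // jl; move: eq_seg.
  by rewrite (negPf (seg_neq s_gt0 jl (lt_n l))).
by rewrite eq_sym (negPf (seg_neq s_gt0 jl (lt_n j))).
Qed.

Lemma prod_seg (A : comNzRingType) (n s j : nat) (f : nat -> A) (c : A) :
  (0 < s)%N -> (j.+1 * s < n)%N ->
  (forall v, j * s < v < j.+1 * s -> f v = c)%N ->
  \prod_(v in seg n s j) f v = f (j * s)%N * (f (j.+1 * s)%N * c ^+ s.-1).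
Proof.
move=> s_gt0 jn fc; have js : (j * s < j.+1 * s)%N by rewrite ltn_pmul2r.
have -> : seg n s j = Ordinal (ltn_trans js jn) |: (Ordinal jn |:
    [set v : 'I_n | (j * s).+1 <= v < j.+1 * s]%N).
  by apply/setP => v; rewrite !inE -!val_eqE /=; lia.
rewrite big_setU1 ?big_setU1 ?inE -?val_eqE /=; try lia.
rewrite (eq_bigr (fun=> c)) => [|v]; last by rewrite inE; apply: fc.
rewrite prodr_const card_itv 1?ltnW // (_ : j.+1 * s - (j * s).+1 = s.-1)%N //; lia.
Qed.

Lemma prod_pt_itv (A : comNzRingType) (n v0 a b : nat) (f : nat -> A) (c : A) :
  (v0 < n)%N -> (b <= n)%N -> ~~ (a <= v0 < b)%N ->
  (forall v, a <= v < b -> f v = c)%N ->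
  \prod_(v in [set v : 'I_n | (v == v0 :> nat) || (a <= v < b)%N]) f v =
  f v0 * c ^+ (b - a).
Proof.
move=> v0n bn v0ab fc.
have -> : [set v : 'I_n | (v == v0 :> nat) || (a <= v < b)%N] =
    Ordinal v0n |: [set v : 'I_n | (a <= v < b)%N] by apply/setP => v; rewrite !inE.
rewrite big_setU1 ?inE //= (eq_bigr (fun=> c)) => [|v]; last by rewrite inE; apply: fc.
by rewrite prodr_const card_itv.
Qed.

(* [a ^+ r = 1 / 2], so that [a ^- 2] is the [r]-th root of [4]. *)
Definition path_weight (A : pzRingType) (s : nat) (a : A) (v : nat) : A :=
  if (s %| v)%N then 1 else a.

(** [v < s] is the first path edge without [v_2]; [k.+2 * s < v] is the last path edge without
    [v_(N-2)], together with the new vertices of both pendent edges. *)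
Definition W_weight (A : pzRingType) (s k : nat) (a : A) (v : nat) : A :=
  if (v < s)%N || (k.+2 * s < v)%N then a ^+ 2 else path_weight s a v.

(** This is the weight product over an edge with both joints of weight [1] and its [s.-1] inner
    vertices of weight [a]. *)
Lemma expr_pred2 (R : realType) (s : nat) (a : R) :
  (0 < s)%N -> 0 < a -> a ^+ s.+1 = 2%:R^-1 -> a ^+ s.-1 = a ^- 2 / 2%:R.
Proof.
move=> s_gt0 a_gt0 as1.
rewrite -as1; apply: (mulfI (x := a ^+ 2)); first by rewrite expf_neq0 // gt_eqF.
by rewrite mulVKf ?expf_neq0 ?gt_eqF // -exprD; congr (_ ^+ _); lia.
Qed.

(** After multiplication by the weight at [i], each edge contributes [a ^- 2 / 2]. A vertex of
    weight [a] lies on one edge and has [a ^+ s.+1 = 1/2]; a joint lies on at most two edges. *)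
Lemma path_seg_supersolution (R : realType) (s t : nat) (a : R) (i : 'I_(hv (path_seg s t))) :
  (0 < s)%N -> 0 < a -> a ^+ s.+1 = 2%:R^-1 ->
  edge_sum (K := path_seg s t) (fun v => path_weight s a v) i <=
  a ^- 2 * path_weight s a i ^+ s.
Proof.
move=> s_gt0 a_gt0 as1; set z := path_weight s a.
have z_gt0 v : 0 < z v by rewrite /z /path_weight; case: ifP.
rewrite -(ler_pM2l (z_gt0 i)) (edge_sumM (K := path_seg s t) (fun v => z v)) mulrCA -exprS.
rewrite sum_segs //=; last by lia.
rewrite (eq_bigr (fun=> a ^+ s.-1)) => [|j _]; last first.
  have js : (j.+1 * s < (t * s).+1)%N by rewrite ltnS leq_pmul2r.
  rewrite (prod_seg (c := a)) //.
    by rewrite /z /path_weight !dvdn_mull // !mul1r.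
  move=> v vj; rewrite /z /path_weight; case: ifP => // /dvdnP[q v_q].
  by move: vj; rewrite v_q !ltn_pmul2r //; lia.
rewrite (sum_seg _ _ (fun=> a ^+ s.-1)) // (expr_pred2 s_gt0 a_gt0 as1) /z /path_weight.
have rho_gt0 : 0 < a ^- 2 by rewrite invr_gt0 exprn_gt0.
case: (s %| i)%N => /=; rewrite ?expr1n ?as1.
  by do 2![case: ifP => _]; lra.
by case: ifP => _; lra.
Qed.

Lemma uniform_loose_path (r t : nat) : (1 < r)%N -> uniform r (loose_path r t).
Proof.
move=> r_gt1 _ /imsetP[j _ ->].
rewrite (@card_seg _ (r - 1)); first by lia.
by rewrite ltnS leq_pmul2r //; lia.
Qed.

Lemma uniform_W_graph (r k : nat) : (1 < r)%N -> uniform r (W_graph r (k + 5)).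
Proof.
move=> r_gt1; rewrite W_graphE => e.
have s_gt0 : (0 < r - 1)%N by lia.
case/setUP=> [/imsetP[j _ ->]|/set2P[] ->]; last 2 first.
- by rewrite card_pend_l //; lia.
- by rewrite card_pend_r //; lia.
rewrite card_seg; first by lia.
have := leq_mul (ltn_ord j) (leqnn (r - 1)); rewrite /= /W_size; lia.
Qed.

(** After multiplication by the weight at [i], each of the four end edges contributes [a ^- 2 / 4]
    and each other edge [a ^- 2 / 2]. Vertices of weight [a ^+ 2] or [a] lie on one edge; [v_2] and
    [v_(N-2)] lie on two end edges and one other, and the remaining joints on two edges that are not
    end edges. *)
Lemma W_seg_eigenvector (R : realType) (s k : nat) (a : R) (i : 'I_(hv (W_seg s k))) :
  (0 < s)%N -> 0 < a -> a ^+ s.+1 = 2%:R^-1 ->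
  edge_sum (K := W_seg s k) (fun v => W_weight s k a v) i = a ^- 2 * W_weight s k a i ^+ s.
Proof.
move=> s_gt0 a_gt0 as1; set z := W_weight s k a.
have z_gt0 v : 0 < z v by rewrite /z /W_weight /path_weight; do 2?case: ifP; rewrite // exprn_gt0.
have as_eq := expr_pred2 s_gt0 a_gt0 as1.
have rho_neq0 : a ^+ 2 != 0 by rewrite expf_neq0 // gt_eqF.
have a2s : (a ^+ 2) ^+ s = a ^- 2 / 4%:R.
  apply: (mulfI rho_neq0); rewrite mulVKf // -exprS -exprM mulnC exprM as1.
  by rewrite exprVn -natrX.
have z_s : z s = 1 by rewrite /z /W_weight /path_weight ltnn dvdnn ltnNge leq_pmull.
have z_k2s : z (k.+2 * s)%N = 1.
  by rewrite /z /W_weight /path_weight ltnn dvdn_mull // ltnNge leq_pmull.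
apply: (mulfI (lt0r_neq0 (z_gt0 i))).
rewrite (edge_sumM (K := W_seg s k) (fun v => z v)) mulrCA -exprS /=.
have pend_l_notin : pend_l s k \notin [set seg (W_size s k) s j | j : 'I_k.+3].
  by apply/imsetP => -[j _ /eqP]; rewrite (negPf (pend_l_neq_seg _ _)).
have pend_r_notin : pend_r s k \notin [set seg (W_size s k) s j | j : 'I_k.+3].
  by apply/imsetP => -[j _ /eqP]; rewrite (negPf (pend_r_neq_seg _ _)).
rewrite big_mkcondr setUC -setUA big_setU1 /=; last by rewrite in_setU1 negb_or pend_neq.
rewrite big_setU1 //=.
rewrite -big_mkcondr sum_segs //; last by rewrite /W_size; lia.
rewrite (prod_pt_itv (c := a ^+ 2)); first last.
- by move=> v v_itv; rewrite /z /W_weight /path_weight ifT //; lia.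
- by lia.
- by rewrite /W_size; lia.
- by rewrite /W_size; lia.
rewrite (prod_pt_itv (c := a ^+ 2)); first last.
- by move=> v v_itv; rewrite /z /W_weight /path_weight ifT //; lia.
- by lia.
- by rewrite /W_size; lia.
- by rewrite /W_size; lia.
rewrite z_s z_k2s !mul1r addKn (_ : W_size s k - _ = s)%N; last by rewrite /W_size; lia.
(* The weight product over path edge [j]; edges [0] and [k.+2] have all vertices but one of weight
   [a ^+ 2]. *)
pose w j := if (j == 0)%N || (j == k.+2)%N then a ^- 2 / 4%:R else a ^- 2 / 2%:R.
rewrite (eq_bigr (fun j : 'I_k.+3 => w j)) => [|j _]; last first.
  have js : (j.+1 * s < W_size s k)%N.
    have := leq_mul (ltn_ord j) (leqnn s); rewrite /W_size; lia.
  have jk := ltn_ord j; rewrite /w.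
  have [j0|j_gt0] := posnP j; last have [jk2|neq_jk2] := eqVneq (j : nat) k.+2 => /=.
  - rewrite (prod_seg (c := a ^+ 2)) // => [|v]; last first.
      by rewrite j0 /z /W_weight mul1n => /andP[_ ->].
    by rewrite j0 mul0n mul1n z_s mul1r /z /W_weight s_gt0 /= -exprS prednK.
  - rewrite (prod_seg (c := a ^+ 2)) // => [|v]; last first.
      by rewrite jk2 /z /W_weight => /andP[-> _]; rewrite orbT.
    rewrite jk2 z_k2s mul1r /z /W_weight ltn_pmul2r // ltnSn orbT -exprS prednK //.
  - have zj m : (0 < m)%N -> (m <= k.+2)%N -> z (m * s)%N = 1.
      move=> m_gt0 mk; rewrite /z /W_weight /path_weight dvdn_mull // ifF //.
      by rewrite ltn_pmul2r // ltnNge leq_pmull // ltnNge mk.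
    rewrite (prod_seg (c := a)) // => [|v /andP[jv vj]].
      by rewrite !zj ?mul1r //; lia.
    rewrite /z /W_weight /path_weight ifF; last first.
      apply/negbTE; rewrite negb_or -!leqNgt; apply/andP; split.
        by apply: leq_trans (ltnW jv); rewrite leq_pmull.
      by apply: leq_trans (ltnW vj) _; rewrite leq_pmul2r //; lia.
    rewrite ifF //; apply/negP => /dvdnP[q v_q].
    by move: jv vj; rewrite v_q !ltn_pmul2r //; lia.
rewrite (sum_seg _ _ w) // a2s {as_eq z_gt0 pend_l_notin pend_r_notin a2s z_s z_k2s}.
have z_i : z i ^+ s.+1 =
    if (i < s)%N || (k.+2 * s < i)%N then 4%:R^-1 else if (s %| i)%N then 1 else 2%:R^-1.
  rewrite /z /W_weight /path_weight; do 2?case: ifP => _; rewrite ?expr1n //.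
  by rewrite -exprM mulnC exprM as1 exprVn -natrX.
rewrite z_i {z_i z} !inE /=; move: (ltn_ord i) => /=.
set p0 := (k.+3 * s).+1; set rho := a ^- 2 in w *.
(* Writing the vertex as [q * s + c] turns every test on path positions into one on [q] and on
   whether [c] vanishes. *)
have i_eq := divn_eq i s; have := ltn_pmod i s_gt0; rewrite /dvdn.
move: i_eq; move: (nat_of_ord i) (i %/ s)%N (i %% s)%N => v q c v_eq cs vW.
have ltE m : (m * s < v)%N = (m < q)%N || (m == q)%N && (0 < c)%N.
  by rewrite v_eq; have [->|neq_mq] /= := eqVneq m q; nia.
have v_s : (v < s)%N = (q == 0)%N by nia.
have eqE m : (v == m * s)%N = (q == m)%N && (c == 0)%N.
  by rewrite v_eq; have [->|neq_mq] /= := eqVneq q m; nia.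
have := eqE 1%N; rewrite mul1n => ->; rewrite eqE v_s ltE.
have -> : ((k.+3 * s).+1 + s <= v < W_size s k)%N = (p0 <= v)%N && ~~ (v < p0 + s)%N.
  by rewrite vW /p0; lia.
(* Beyond the path, only the side of [p0 + s] matters, as it tells the two pendent edges apart; a
   boolean suffices for it. *)
rewrite {1 2}/p0 !ltE -/p0 /w; move: (v < p0 + s)%N => in_pend_l.
clear -rho; case: in_pend_l; rewrite ?andbT ?andbF ?orbF /=;
  repeat (case: ifP => ?; try (exfalso; lia)); lra.
Qed.

(** * Common value of the spectral radii *)

Lemma exists_root_half (R : realType) (r : nat) : (0 < r)%N ->
  exists2 a : R, 0 < a & a ^+ r = 2%:R^-1.
Proof.
move=> r_gt0; pose p : {poly R} := 'X^r - (2%:R^-1)%:P.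
have pE x : p.[x] = x ^+ r - 2%:R^-1 by rewrite !hornerE.
have [||a a01] := @poly_ivt _ p 0 1; first exact: ler01.
  by rewrite !pE expr0n expr1n eqn0Ngt r_gt0 /=; apply/andP; split; lra.
rewrite /root pE subr_eq0 => /eqP ar; exists a => //.
have /andP[a_ge0 _] := a01; rewrite lt_neqAle a_ge0 andbT eq_sym.
by apply: contra_eq_neq ar => ->; rewrite expr0n eqn0Ngt r_gt0 eq_sym invr_eq0 pnatr_eq0.
Qed.

(** The value does not depend on [t] or [k]: [W_N] attains it and the path cannot exceed it. *)
Lemma spectral_radius_path_W (R : realType) (r t k : nat) (a : R) :
  (1 < r)%N -> 0 < a -> a ^+ r = 2%:R^-1 ->
  spectral_radius R r (hunion (loose_path r t) (W_graph r (k + 5))) = a ^- 2.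
Proof.
move=> r_gt1 a_gt0 ar; have s_gt0 : (0 < r - 1)%N by lia.
have r_pred : r.-1 = (r - 1)%N by rewrite subn1.
have as1 : a ^+ (r - 1).+1 = 2%:R^-1 by rewrite subn1 prednK // ltnW.
have weight_gt0 v : 0 < path_weight (r - 1) a v by rewrite /path_weight; case: ifP.
have := @uniform_W_graph r k r_gt1; rewrite W_graphE => uniW.
apply: (spectral_radius_hunion
  (z1 := fun v : 'I_(hv (loose_path r t)) => path_weight (r - 1) a v)
  (z2 := fun v : 'I_(hv (W_seg (r - 1) k)) => W_weight (r - 1) k a v)) => //.
- exact: uniform_loose_path.
- by move=> i; rewrite /W_weight; case: ifP => // _; rewrite exprn_gt0.
- by rewrite invr_ge0 exprn_ge0 // ltW.
- by move=> i; rewrite r_pred; apply: path_seg_supersolution.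
- by move=> i; rewrite r_pred; apply: W_seg_eigenvector.
Qed.

Theorem theorem8 (R : realType) (m n r : nat) :
  (6 <= m)%N -> (6 <= n)%N -> (3 <= r)%N ->
  spectral_radius R r (hunion (loose_path r (m - 5)) (W_graph r (n - 1))) =
  spectral_radius R r (hunion (loose_path r (n - 5)) (W_graph r (m - 1))) /\
  matching_energy R r (hunion (loose_path r (m - 5)) (W_graph r (n - 1))) =
  matching_energy R r (hunion (loose_path r (n - 5)) (W_graph r (m - 1))).
Proof.
move=> m6 n6 r3; have r_gt1 : (1 < r)%N by lia.
have [a a_gt0 ar] := @exists_root_half R r (ltnW r_gt1).
(* With [m - 6] and [n - 6] as parameters, the truncated subtractions take the forms [k + 5] and
   [t.+1]. *)
have -> : (m - 1 = (m - 6) + 5)%N by lia.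
have -> : (n - 1 = (n - 6) + 5)%N by lia.
have -> : (m - 5 = (m - 6).+1)%N by lia.
have -> : (n - 5 = (n - 6).+1)%N by lia.
split; last exact: matching_energy_path_W_sym.
by rewrite !(spectral_radius_path_W _ _ r_gt1 a_gt0 ar).
Qed.
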